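(* Let $G=(I\uplus S\uplus O,E)$ be an $(n,p)$-balancer. Then \[|S|\ \ge\ \frac14\,|I|\,|O|\sum_{k\in\mathbb{N}}\frac{k}{2^k}\,b_k\!\left(\frac{1}{|O|}\right),\] where $b_k(x)\in\{0,1\}$ denotes the digit of weight $2^{-k}$ in the binary expansion of $x\in[0,1]$.
   Context: A splitter network is a finite directed graph $G$ (loops and parallel arcs allowed) with arc set $E$ whose vertex set is partitioned as $I\uplus S\uplus O$, where each input $i\in I$ has out-degree $1$ and in-degree $0$, each output $o\in O$ has in-degree $1$ and out-degree $0$, and each splitter $s\in S$ has in-degree $2$ and out-degree $2$. $\delta^+(v),\delta^-(v)$ denote outgoing/incoming arcs of $v$, and $\delta^-(O)$ the set of arcs entering outputs. A capacity function is a map $c:I\cup O\to[0,1]$. A steady-state for $(G,c)$ is a pair $(t,F)$ with $t:E\to[0,1]$ and $F\subseteq E$ (fluid arcs; arcs of $E\setminus F$ are saturated) such that: (R3) for each input $i$ with $\delta^+(i)=\{e\}$, $t(e)\le c(i)$, and if $e\in F$ then $t(e)=c(i)$; (R4) for each output $o$ with $\delta^-(o)=\{e\}$, $t(e)\le c(o)$, and if $e\notin F$ then $t(e)=c(o)$; (R5) for each splitter $s$, $t(\delta^-(s))=t(\delta^+(s))$; (R6) for each splitter $s$ with $\delta^-(s)=\{e_1,e_2\}$ and $e_1\notin F$, $t(e_1)\ge t(e_2)$; (R7) for each splitter $s$ with $\delta^+(s)=\{e_1,e_2\}$ and $e_1\in F$, $t(e_1)\ge t(e_2)$; (R8) for any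 arcs $uv\in E\setminus F$ and $vw\in F$, $t(uv)=1$ or $t(vw)=1$. A splitter network is a balancer if for every capacity function $c$ with $c(o)=1$ for all $o\in O$ there is a steady-state $(t,F)$ for $(G,c)$ with $t$ constant on $\delta^-(O)$. An $(n,p)$-balancer is a balancer with $|I|=n$ and $|O|=p$. *)

(* Defs.v *)
From HB Require Import structures.
From mathcomp Require Import all_boot all_order all_algebra.
From mathcomp Require Import all_classical all_reals all_analysis.
From mathcomp Require Import ring lra.
Set Implicit Arguments.
Unset Strict Implicit.
Unset Printing Implicit Defensive.
Import Order.TTheory GRing.Theory Num.Theory.
Import numFieldNormedType.Exports.
Local Open Scope ring_scope.

(* Loops and parallel arcs are allowed: arcs form their own type.  A loop at v
   counts once in arcs_out v and once in arcs_in v. *)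
Record digraph := Digraph {
  vertex : finType;
  arc : finType;
  src : arc -> vertex;
  tgt : arc -> vertex
}.

Definition arcs_out (G : digraph) (v : vertex G) : {set arc G} :=
  [set e | src e == v].

Definition arcs_in (G : digraph) (v : vertex G) : {set arc G} :=
  [set e | tgt e == v].

(* Arcs uv with u outside A and v in A. *)
Definition arcs_into (G : digraph) (A : {set vertex G}) : {set arc G} :=
  [set e | (src e \notin A) && (tgt e \in A)].

(* The three vertex classes may be empty, so [finset.partition], which forbids
   empty blocks, is not used. *)
Record splitter_network := SplitterNetwork {
  graph :> digraph;
  inputs : {set vertex graph};
  splitters : {set vertex graph};
  outputs : {set vertex graph};
  vertices_cover : inputs :|: splitters :|: outputs = [set: vertex graph];
  inputs_splitters_disjoint : [disjoint inputs & splitters];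
  inputs_outputs_disjoint : [disjoint inputs & outputs];
  splitters_outputs_disjoint : [disjoint splitters & outputs];
  input_degrees : forall i, i \in inputs ->
    #|arcs_out i| = 1%N /\ #|arcs_in i| = 0%N;
  output_degrees : forall o, o \in outputs ->
    #|arcs_in o| = 1%N /\ #|arcs_out o| = 0%N;
  splitter_degrees : forall s, s \in splitters ->
    #|arcs_in s| = 2 /\ #|arcs_out s| = 2
}.

Section SteadyStates.
Variables (R : realType) (G : splitter_network).

(* A capacity function lives on inputs and outputs; its values at splitters are
   unconstrained and never used. *)
Definition capacity_function (c : vertex G -> R) : Prop :=
  forall v, v \in inputs G :|: outputs G -> 0 <= c v <= 1.

Record steady_state (c : vertex G -> R) (t : arc G -> R) (F : {set arc G}) :
    Prop := SteadyState {
  throughput_range : forall e, 0 <= t e <= 1;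
  input_rule : forall i e, i \in inputs G -> arcs_out i = [set e] ->
    t e <= c i /\ (e \in F -> t e = c i);
  output_rule : forall o e, o \in outputs G -> arcs_in o = [set e] ->
    t e <= c o /\ (e \notin F -> t e = c o);
  conservation : forall s, s \in splitters G ->
    \sum_(e in arcs_in s) t e = \sum_(e in arcs_out s) t e;
  incoming_rule : forall s e1 e2, s \in splitters G ->
    arcs_in s = [set e1; e2] -> e1 \notin F -> t e2 <= t e1;
  outgoing_rule : forall s e1 e2, s \in splitters G ->
    arcs_out s = [set e1; e2] -> e1 \in F -> t e2 <= t e1;
  maximality : forall e f, tgt e = src f -> e \notin F -> f \in F ->
    t e = 1 \/ t f = 1
}.

Definition balancer : Prop :=
  forall c : vertex G -> R, capacity_function c ->
    (forall o, o \in outputs G -> c o = 1) ->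
    exists (t : arc G -> R) (F : {set arc G}), steady_state c t F /\
      {in arcs_into (outputs G) &, forall e f, t e = t f}.

Definition np_balancer (n p : nat) : Prop :=
  [/\ balancer, #|inputs G| = n & #|outputs G| = p].

End SteadyStates.

Section BinaryDigits.
Variable R : realType.

(* Dyadic rationals get their terminating expansion; in particular the digits
   of 1 are 1, 0, 0, and so on, with digit 0 of weight 1. *)
Definition binary_digit (k : nat) (x : R) : nat :=
  (Num.truncn (2 ^+ k * x) %% 2)%N.

Lemma binary_digit_sum (x : R) n : 0 <= x <= 1 ->
  \sum_(0 <= k < n.+1) (binary_digit k x)%:R / 2 ^+ k =
  (Num.truncn (2 ^+ n * x))%:R / 2 ^+ n :> R.
Proof.
move=> /andP[x0 x1]; elim: n => [|n IHn].
  rewrite big_nat1 /binary_digit expr0 mul1r modn_small //.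
  by rewrite truncn_lt_nat //; apply: le_lt_trans x1 _; rewrite ltr1n.
have y0 : 0 <= 2 ^+ n * x by rewrite mulr_ge0// exprn_ge0.
rewrite big_nat_recr //= IHn /binary_digit exprS -mulrA.
set y := 2 ^+ n * x in y0 *.
have half : (Num.truncn (2 * y) %/ 2)%N = Num.truncn y.
  have y20 : 0 <= 2 * y by rewrite mulr_ge0.
  have /andP[yl yu] := truncn_itv y0.
  have l : (2 * Num.truncn y <= Num.truncn (2 * y))%N.
    by rewrite truncn_ge_nat // natrM ler_pM2l.
  have u : (Num.truncn (2 * y) < 2 * (Num.truncn y).+1)%N.
    by rewrite truncn_lt_nat // natrM ltr_pM2l.
  by apply/eqP; rewrite eqn_leq leq_divRL // -ltnS ltn_divLR // !(mulnC _ 2) l u.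
have p0 : (2 : R) ^+ n != 0 by rewrite expf_neq0.
rewrite [in RHS](divn_eq (Num.truncn (2 * y)) 2) half natrD natrM.
by field.
Qed.

Lemma binary_expansion (x : R) : 0 <= x <= 1 ->
  (series (fun k => (binary_digit k x)%:R / 2 ^+ k : R) @ \oo --> x)%classic.
Proof.
move=> x01; have /andP[x0 _] := x01; rewrite -cvg_shiftS.
have half0 : (@geometric R 1 2^-1 @ \oo --> 0)%classic.
  by apply: cvg_geometric; rewrite ger0_norm // invf_lt1 // ltr1n.
have := cvgB (cvg_cst x) half0; rewrite subr0 => lo.
apply: squeeze_cvgr; [|exact: lo|exact: cvg_cst]; apply: nearW => n /=.
have p : 0 < (2 : R) ^+ n by rewrite exprn_gt0.
rewrite /series /= binary_digit_sum //.
have /truncn_itv/andP[l u] : 0 <= 2 ^+ n * x by rewrite mulr_ge0 // ltW.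
rewrite ler_pdivrMr // [x * _]mulrC l andbT.
rewrite ler_pdivlMr // mulrBl /geometric /= mul1r exprVn mulVf ?gt_eqF // lerBlDr mulrC.
by rewrite natr1 ltW.
Qed.

(* [limn] is total; this lemma makes it the sum of the series. *)
Lemma is_cvg_weighted_digits (x : R) :
  cvgn (series (fun k => k%:R / 2 ^+ k * (binary_digit k x)%:R : R)).
Proof.
have two n : 0 < (2 : R) ^+ n by rewrite exprn_gt0.
apply: nondecreasing_is_cvgn.
  apply: nondecreasing_series => k _ _.
  by rewrite mulr_ge0 // divr_ge0 // ltW.
exists 2 => _ [n _ <-] /=; rewrite /series /=.
suff H : \sum_(0 <= k < n) (k%:R / 2 ^+ k * (binary_digit k x)%:R : R)
         <= 2 - 2 * n.+1%:R / 2 ^+ n.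
  by apply: le_trans H _; rewrite gerBl divr_ge0 ?mulr_ge0 // ltW.
elim: n => [|n IHn]; first by rewrite big_geq // expr0 divr1 mulr1 subrr.
rewrite big_nat_recr //=.
have d1 : (binary_digit n x)%:R <= 1 :> R.
  by rewrite -[1]/(1%:R) ler_nat -ltnS ltn_mod.
have s : n%:R / 2 ^+ n * (binary_digit n x)%:R <= n%:R / 2 ^+ n :> R.
  by rewrite ler_piMr // divr_ge0 // ltW.
apply: le_trans (lerD IHn s) _.
rewrite exprS -[n.+2]addn2 -[n.+1]addn1 !natrD le_eqVlt; apply/orP; left.
by apply/eqP; field; rewrite gt_eqF.
Qed.

End BinaryDigits.

(* Main.v *)
(* Give one input a capacity so small that no congestion can occur: every arc
   leading to an output is then fluid, and after rescaling the steady state is a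
   unit flow that every splitter halves and that reaches each of the p outputs
   in quantity 1/p.  By Abel summation the digit sum of the theorem is
   nu(x) = sum_k frac(2^k x) / 2^k, which is subadditive and satisfies
   2 nu(x/2) <= x + nu(x).  Hence a splitter raises the sum of nu over its arcs
   by at most its throughput; as nu vanishes at 0 and 1, summing over the
   splitters bounds the total throughput of the unit flow below by p nu(1/p).
   By a maximum principle the sum of the unit flows of all inputs is at most 1
   on every arc, so each splitter carries at most 2, and
   2 |S| >= |I| p nu(1/p). *)
Require Import Defs.
From HB Require Import structures.
From mathcomp Require Import all_boot all_order all_algebra.
From mathcomp Require Import all_classical all_reals all_analysis.
From mathcomp Require Import ring lra.
Set Implicit Arguments.
Unset Strict Implicit.
Unset Printing Implicit Defensive.
Import Order.TTheory GRing.Theory Num.Theory.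
Import numFieldNormedType.Exports.
Local Open Scope ring_scope.

(** * Fractional parts and the digit potential *)

Section DigitPotential.
Variable R : realType.
Implicit Types x y : R.

Definition frac x : R := x - (Num.truncn x)%:R.

Lemma frac_ge0 x : 0 <= x -> 0 <= frac x.
Proof. by move=> /truncn_itv/andP[l _]; rewrite subr_ge0. Qed.

Lemma frac_le x : frac x <= x.
Proof. by rewrite gerBl. Qed.

Lemma frac_nat n : frac n%:R = 0.
Proof. by rewrite /frac natrK subrr. Qed.

Lemma frac_subadd x y : 0 <= x -> 0 <= y -> frac (x + y) <= frac x + frac y.
Proof.
move=> x0 y0; rewrite /frac.
have /andP[lx _] := truncn_itv x0; have /andP[ly _] := truncn_itv y0.
have : (Num.truncn x + Num.truncn y <= Num.truncn (x + y))%N.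
  by rewrite truncn_ge_nat ?addr_ge0 // natrD lerD.
rewrite -(ler_nat R) natrD; lra.
Qed.

Lemma truncn_double x : 0 <= x ->
  (Num.truncn (2 * x) %/ 2)%N = Num.truncn x.
Proof.
move=> x0; have /andP[l u] := truncn_itv x0.
have x20 : 0 <= 2 * x by rewrite mulr_ge0.
apply/eqP; rewrite eqn_leq leq_divRL // -ltnS ltn_divLR // !(mulnC _ 2).
by rewrite truncn_ge_nat // truncn_lt_nat // !natrM ler_pM2l // ltr_pM2l // u.
Qed.

(** The first [m] terms of [nu]; working with partial sums postpones every limit to the final
    theorem. *)
Definition digit_potential (m : nat) x : R :=
  \sum_(0 <= k < m) frac (2 ^+ k * x) / 2 ^+ k.

Lemma digit_potential_subadd m x y : 0 <= x -> 0 <= y ->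
  digit_potential m (x + y) <= digit_potential m x + digit_potential m y.
Proof.
move=> x0 y0; rewrite -big_split /=; apply: ler_sum => k _.
rewrite -mulrDl ler_pM2r ?invr_gt0 ?exprn_gt0 // mulrDr.
by apply: frac_subadd; rewrite mulr_ge0 // exprn_ge0.
Qed.

Lemma digit_potential_nat m n : digit_potential m n%:R = 0.
Proof.
by apply: big1 => k _; rewrite -natrX -natrM frac_nat mul0r.
Qed.

Lemma digit_potential_sum (I : finType) (A : {set I}) (f : I -> R) m :
  (forall i, 0 <= f i) ->
  digit_potential m (\sum_(i in A) f i) <=
  \sum_(i in A) digit_potential m (f i).
Proof.
move=> f0.
suff [] : 0 <= \sum_(i in A) f i /\ digit_potential m (\sum_(i in A) f i) <=
  \sum_(i in A) digit_potential m (f i) by [].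
apply: (big_rec2 (fun s t => 0 <= s /\ digit_potential m s <= t)).
  by rewrite -[X in digit_potential m X]/(0%:R) digit_potential_nat.
move=> i t s _ [s0 st]; split; first by rewrite addr_ge0.
by apply: le_trans (digit_potential_subadd _ _ _) _ => //; rewrite lerD2l.
Qed.

(** The terms for [x / 2] after the first are halves of the terms for [x], by an index shift; the
    first one is [frac (x / 2) <= x / 2]. *)
Lemma digit_potential_half m x : 0 <= x ->
  2 * digit_potential m (x / 2) <= x + digit_potential m x.
Proof.
move=> x0; case: m => [|m]; first by rewrite /digit_potential !big_geq // mulr0 addr0.
rewrite {1}/digit_potential big_nat_recl //= mulrDr expr0 mul1r divr1; apply: lerD.
  by have := frac_le (x / 2); lra.
rewrite mulr_sumr /digit_potential big_nat_recr //= -[leLHS]addr0; apply: lerD.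
  apply: ler_sum => k _; rewrite le_eqVlt; apply/orP; left; apply/eqP.
  have -> : 2 ^+ k.+1 * (x / 2) = 2 ^+ k * x by rewrite exprS; field.
  by rewrite exprS; field; rewrite expf_neq0.
by rewrite divr_ge0 ?exprn_ge0 ?frac_ge0 // mulr_ge0 ?exprn_ge0.
Qed.

(** With [y = 2 ^+ k * x], the integer part of [2 * y] is twice that of [y] plus the digit. *)
Lemma binary_digit_frac k x : 0 <= x ->
  (binary_digit k.+1 x)%:R / 2 ^+ k.+1 =
  frac (2 ^+ k * x) / 2 ^+ k - frac (2 ^+ k.+1 * x) / 2 ^+ k.+1 :> R.
Proof.
move=> x0; rewrite /binary_digit /frac exprS -mulrA; set y := 2 ^+ k * x.
have y0 : 0 <= y by rewrite mulr_ge0 // exprn_ge0.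
have := divn_eq (Num.truncn (2 * y)) 2; rewrite truncn_double // => E.
rewrite [in RHS]E natrD natrM.
by field; rewrite expf_neq0.
Qed.

(* Abel summation: the digit of weight [2 ^- k.+1] is the drop from
   [frac (2 ^+ k * x) / 2 ^+ k] to the next term. *)
Lemma weighted_digits m x : 0 <= x ->
  \sum_(0 <= k < m.+1) k%:R / 2 ^+ k * (binary_digit k x)%:R
    + m%:R * (frac (2 ^+ m * x) / 2 ^+ m) = digit_potential m x :> R.
Proof.
move=> x0; elim: m => [|m IH].
  by rewrite big_nat1 /digit_potential big_geq // !mul0r addr0.
rewrite big_nat_recr //= [RHS]big_nat_recr //= -/(digit_potential m x) -IH.
rewrite [in LHS]mulrAC -[X in _ + X + _]mulrA binary_digit_frac // -natr1; ring.
Qed.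

Lemma weighted_digits_le m x : 0 <= x ->
  \sum_(0 <= k < m) k%:R / 2 ^+ k * (binary_digit k x)%:R
    <= digit_potential m x.
Proof.
move=> x0; rewrite -weighted_digits // big_nat_recr //= -addrA lerDl.
rewrite addr_ge0 ?mulr_ge0 ?invr_ge0 ?exprn_ge0 ?frac_ge0 //.
by rewrite mulr_ge0 ?exprn_ge0.
Qed.

End DigitPotential.

Local Notation arc := Defs.arc.

(** * Arcs and degrees in a splitter network *)

Section Networks.
Variable G : splitter_network.
Implicit Types (v s : vertex G) (e : arc G).

Lemma vertex_cases v :
  [|| v \in inputs G, v \in splitters G | v \in outputs G].
Proof.
by have := finset.in_setT v; rewrite -vertices_cover !inE orbA.
Qed.

(* In [Defs] the numeral 2 is the ring element [2%:R] of [nat]. *)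
Lemma splitter_cards s : s \in splitters G ->
  #|arcs_in s| = 2%N /\ #|arcs_out s| = 2%N.
Proof. exact: splitter_degrees. Qed.

Lemma arc_src_cases e : src e \in inputs G \/ src e \in splitters G.
Proof.
case/or3P: (vertex_cases (src e)) => [||o]; [by left|by right|].
by have [_ /cards0_eq/setP/(_ e)] := output_degrees o; rewrite !inE eqxx.
Qed.

Lemma arc_tgt_cases e : tgt e \in splitters G \/ tgt e \in outputs G.
Proof.
case/or3P: (vertex_cases (tgt e)) => [i||]; [|by left|by right].
by have [_ /cards0_eq/setP/(_ e)] := input_degrees i; rewrite !inE eqxx.
Qed.

Lemma in_arcs_out e : e \in arcs_out (src e).
Proof. by rewrite inE. Qed.

Lemma in_arcs_in e : e \in arcs_in (tgt e).
Proof. by rewrite inE. Qed.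

Lemma arcs_out_input e : src e \in inputs G -> arcs_out (src e) = [set e].
Proof.
move=> i; have [/eqP/cards1P[f E] _] := input_degrees i.
by have := in_arcs_out e; rewrite E inE => /eqP->.
Qed.

Lemma arcs_in_output e : tgt e \in outputs G -> arcs_in (tgt e) = [set e].
Proof.
move=> o; have [/eqP/cards1P[f E] _] := output_degrees o.
by have := in_arcs_in e; rewrite E inE => /eqP->.
Qed.

Lemma arcs_out_splitter e : src e \in splitters G ->
  exists2 f, f != e & arcs_out (src e) = [set e; f].
Proof.
move=> s; have [_ /eqP/cards2P[a [b [ab E]]]] := splitter_cards s.
have := in_arcs_out e; rewrite {1}E !inE => /orP[]/eqP ee.
  by exists b; [rewrite ee eq_sym | rewrite E {1}ee].
by exists a; [rewrite ee | rewrite E {1}ee finset.setUC].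
Qed.

(** * Reachability of outputs *)

Definition arc_rel : rel (vertex G) :=
  [rel u v | [exists e : arc G, (src e == u) && (tgt e == v)]].

Lemma arc_relP e : arc_rel (src e) (tgt e).
Proof. by apply/existsP; exists e; rewrite !eqxx. Qed.

(** Arcs whose head reaches no output may be saturated however little the inputs supply, so fluidity
    is claimed only where this holds. *)
Definition alive v := [exists o in outputs G, connect arc_rel v o].

Lemma alive_output v : v \in outputs G -> alive v.
Proof. by move=> o; apply/exists_inP; exists v. Qed.

Lemma alive_src e : alive (tgt e) -> alive (src e).
Proof.
case/exists_inP => o oO c; apply/exists_inP; exists o => //.
exact: connect_trans (connect1 (arc_relP e)) c.
Qed.

(** Members of [A] have in-degree and out-degree 2, so both counts are twice [#|A|]. *)
Lemma card_arcs_splitters (A : {set vertex G}) : A \subset splitters G ->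
  #|[set e : arc G | src e \in A]| = #|[set e : arc G | tgt e \in A]|.
Proof.
move=> /fintype.subsetP sA; rewrite -!sum1_card.
rewrite (partition_big (@src G) (mem A)) /=; last by move=> e; rewrite inE.
rewrite [RHS](partition_big (@tgt G) (mem A)) /=; last by move=> e; rewrite inE.
apply: eq_bigr => s /[dup] As /sA/splitter_cards[i o].
transitivity #|arcs_out s|.
  rewrite -sum1_card; apply: eq_bigl => e; rewrite !inE.
  by case: eqP => [->|]; rewrite ?As ?andbF.
rewrite o -i -sum1_card; apply: eq_bigl => e; rewrite !inE.
by case: eqP => [->|]; rewrite ?As ?andbF.
Qed.

(** Closure in one direction includes one of the two arc sets of [card_arcs_splitters] in the other;
    equal cardinality makes them coincide. *)
Lemma splitters_closed (A : {set vertex G}) : A \subset splitters G ->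
  (forall e, src e \in A -> tgt e \in A) <->
  (forall e, tgt e \in A -> src e \in A).
Proof.
move=> /card_arcs_splitters cA.
split=> H e eA.
- have /eqP/setP/(_ e) :
      [set e : arc G | src e \in A] == [set e | tgt e \in A].
    rewrite eqEcard cA leqnn andbT; apply/fintype.subsetP => f.
    rewrite !inE; exact: H.
  by rewrite !inE eA.
- have /eqP/setP/(_ e) :
      [set e : arc G | tgt e \in A] == [set e | src e \in A].
    rewrite eqEcard cA leqnn andbT; apply/fintype.subsetP => f.
    rewrite !inE; exact: H.
  by rewrite !inE eA.
Qed.

(* Counting arcs, no arc enters the set of splitters that cannot reach an
   output, because no arc leaves it. *)
Lemma dead_src e : ~~ alive (tgt e) ->
  (src e \in splitters G) && ~~ alive (src e).
Proof.
pose D := [set v in splitters G | ~~ alive v].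
have sD : D \subset splitters G.
  by apply/fintype.subsetP => v; rewrite inE => /andP[].
have Dtgt f : ~~ alive (tgt f) -> tgt f \in D.
  move=> d; rewrite inE d andbT; have [//|o] := arc_tgt_cases f.
  by rewrite alive_output in d.
have [H _] := splitters_closed sD.
have fwd f : src f \in D -> tgt f \in D.
  rewrite inE => /andP[_ dead]; apply: Dtgt; apply: contra dead; exact: alive_src.
by move/Dtgt/(H fwd); rewrite inE.
Qed.

Lemma alive_tgt e : alive (src e) -> alive (tgt e).
Proof. by move=> a; apply: contraT => /dead_src; rewrite a andbF. Qed.

Lemma input_alive_tgt e : src e \in inputs G -> alive (tgt e).
Proof.
move=> i; apply: contraT => /dead_src/andP[s _].
by rewrite (disjointFr (inputs_splitters_disjoint G) i) in s.
Qed.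

(** * Unit flows and the count of splitters *)

Section Flows.
Variable R : realType.
Implicit Types (h t T : arc G -> R).

Lemma sum_vertices (g : vertex G -> R) :
  \sum_v g v = \sum_(i in inputs G) g i + \sum_(s in splitters G) g s
    + \sum_(o in outputs G) g o.
Proof.
rewrite !(big_mkcond (fun v => v \in _)) -!big_split /=; apply: eq_bigr => v _.
case/or3P: (vertex_cases v) => vA; rewrite vA.
- rewrite (disjointFr (inputs_splitters_disjoint G) vA).
  by rewrite (disjointFr (inputs_outputs_disjoint G) vA) !addr0.
- rewrite (disjointFl (inputs_splitters_disjoint G) vA).
  by rewrite (disjointFr (splitters_outputs_disjoint G) vA) add0r addr0.
- rewrite (disjointFl (inputs_outputs_disjoint G) vA).
  by rewrite (disjointFl (splitters_outputs_disjoint G) vA) !add0r.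
Qed.

(** Both sides sum [h] over all arcs, grouped by head on the left and by tail on the right. *)
Lemma sum_arcs h :
  \sum_(o in outputs G) \sum_(e in arcs_in o) h e +
    \sum_(s in splitters G) \sum_(e in arcs_in s) h e =
  \sum_(i in inputs G) \sum_(e in arcs_out i) h e +
    \sum_(s in splitters G) \sum_(e in arcs_out s) h e.
Proof.
have part (f : arc G -> vertex G) :
    \sum_e h e = \sum_v \sum_(e in [set e | f e == v]) h e.
  rewrite (partition_big f predT) //=; apply: eq_bigr => v _.
  by apply: eq_bigl => e; rewrite inE.
have := part (@tgt G); rewrite (part (@src G)) !sum_vertices.
rewrite [X in _ + _ + X = _]big1; last first.
  by move=> o /output_degrees[_ /cards0_eq O]; rewrite -/(arcs_out o) O big_set0.
rewrite [X in _ = X + _ + _]big1; last first.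
  by move=> i /input_degrees[_ /cards0_eq O]; rewrite -/(arcs_in i) O big_set0.
by rewrite add0r addr0 => ->; rewrite addrC.
Qed.

Definition halving T := forall e, src e \in splitters G ->
  2 * T e = \sum_(f in arcs_in (src e)) T f.

(** By [sum_arcs] it suffices to treat one splitter: with inflow [z], both outgoing arcs carry
    [z / 2], and [digit_potential_half] and subadditivity apply. *)
Lemma halving_potential m T : (forall e, 0 <= T e) -> halving T ->
  \sum_(o in outputs G) \sum_(e in arcs_in o) digit_potential m (T e) <=
  \sum_(i in inputs G) \sum_(e in arcs_out i) digit_potential m (T e) +
  \sum_(s in splitters G) \sum_(e in arcs_in s) T e.
Proof.
move=> T0 hT; have E := sum_arcs (fun e => digit_potential m (T e)).
rewrite -(lerD2r (\sum_(s in splitters G)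
  \sum_(e in arcs_in s) digit_potential m (T e))) E -addrA lerD2l -big_split.
apply: ler_sum => s sS /=; set z := \sum_(e in _) T e.
have z0 : 0 <= z by apply: sumr_ge0.
rewrite (eq_bigr (fun=> digit_potential m (z / 2))); last first.
  move=> e; rewrite inE => /eqP es; have := hT e; rewrite es => /(_ sS).
  by rewrite -/z => <-; congr digit_potential; field.
have [_ c] := splitter_cards sS.
rewrite sumr_const c -[leLHS]mulr_natl.
apply: le_trans (digit_potential_half m z0) _; rewrite lerD2l.
exact: digit_potential_sum.
Qed.

(** If the maximum exceeded 1, the splitters whose outgoing arcs all attain it would be closed under
    predecessors, hence under successors, and would include a reachable output. *)
Lemma halving_le1 T : (forall e, 0 <= T e) -> halving T ->
  (forall e, src e \in inputs G -> T e <= 1) ->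
  (forall e, ~~ alive (tgt e) -> T e = 0) ->
  forall e, T e <= 1.
Proof.
move=> T0 hT T1 Td e0.
have [e _ eM] := @arg_maxP _ R _ e0 predT T isT.
apply: le_trans (eM e0 isT) _; rewrite leNgt; apply/negP => M1.
pose A := [set s in splitters G | [forall f, (src f == s) ==> (T f == T e)]].
have sA : A \subset splitters G.
  by apply/fintype.subsetP => v; rewrite inE => /andP[].
have inA f : T f = T e -> src f \in A.
  move=> fM; have [/T1|s] := arc_src_cases f; first by rewrite fM leNgt M1.
  rewrite inE s; apply/forall_inP => g /eqP gf.
  by apply/eqP; have := hT g; rewrite gf -hT // fM => /(_ s); lra.
(* The two arcs entering such a splitter sum to twice the maximum, so each attains it. *)
have bwd f : tgt f \in A -> src f \in A.
  rewrite inE => /andP[s /forall_inP H]; apply: inA.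
  have [_ c] := splitter_cards s.
  have /card_gt0P[g] : (0 < #|arcs_out (tgt f)|)%N by rewrite c.
  rewrite inE => /[dup] gs /H/eqP gM.
  have := hT g; rewrite (eqP gs) gM => /(_ s).
  have [/eqP/cards2P[a [b [ab E]]] _] := splitter_cards s.
  rewrite E big_setU1 ?inE // big_set1.
  have := eM a isT; have := eM b isT; have := in_arcs_in f.
  by rewrite E !inE => /orP[]/eqP-> /= ; lra.
have [_ /(_ bwd) fwd] := splitters_closed sA.
have ale : alive (src e).
  apply: alive_src; apply: contraT => /Td E; move: M1; rewrite E; lra.
have [w wO c] := exists_inP ale.
have clA : fingraph.closed arc_rel (mem A).
  move=> _ _ /existsP[f /andP[/eqP<- /eqP<-]].
  by apply/idP/idP; [exact: fwd|exact: bwd].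
have := closed_connect clA c; rewrite !inA // inE.
by rewrite (disjointFl (splitters_outputs_disjoint G) wO).
Qed.

(* Walking back from the outputs, throughputs at most double at each step, so
   they are too small for [maximality] to allow a saturated arc to enter. *)
Lemma alive_fluid (c : vertex G -> R) t F (eps : R) :
  steady_state c t F -> 0 < eps -> 2 ^+ #|vertex G| * eps <= 1 ->
  (forall o, o \in outputs G -> c o = 1) ->
  (forall e, tgt e \in outputs G -> t e <= eps) ->
  forall e, alive (tgt e) -> e \in F.
Proof.
move=> st eps0 small c1 teps e /exists_inP[w wO /connectP[p pth lst]].
(* A path without repetition has fewer than [#|vertex G|] steps, which keeps the doubled bounds
   below 1. *)
have {p pth lst} [p [pth lst /card_uniqP]] : exists p,
    [/\ path arc_rel (tgt e) p, last (tgt e) p = w & uniq (tgt e :: p)].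
  by have := lst; case/shortenP: pth => q pq uq _ ->; exists q.
move=> /= sz; have {sz} : (size p < #|vertex G|)%N by rewrite -sz max_card.
have bound d : (d < #|vertex G|)%N -> 2 ^+ d * eps < 1.
  by move=> dV; apply: lt_le_trans small; rewrite ltr_pM2r // ltr_eXn2l // ltr1n.
suff : (size p < #|vertex G|)%N -> e \in F /\ t e <= 2 ^+ size p * eps.
  by move=> H /H[].
elim: p e pth lst => [|u p IH] e /=.
  move=> _ eo /bound; rewrite expr0 mul1r => e1.
  have eO : tgt e \in outputs G by rewrite eo.
  split; last exact: teps.
  have [_ H] := output_rule st eO (arcs_in_output eO).
  by apply: contraT => /H; have := teps _ eO; rewrite c1 //; lra.
move=> /andP[/existsP[f /andP[/eqP fe /eqP <-]] pth] lst sz.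
have [fF tf] := IH f pth lst (ltnW sz).
have sS : src f \in splitters G.
  have [s|eO] := arc_tgt_cases e; first by rewrite fe.
  have [_ /cards0_eq/setP/(_ f)] := output_degrees eO.
  by rewrite !inE fe eqxx.
have [g gf E] := arcs_out_splitter sS.
(* As [f] is fluid, its sibling [g] carries no more, so the inflow, and with it [t e], is at most
   [2 * t f]. *)
have tg := outgoing_rule st sS E fF.
have te : t e <= 2 ^+ (size p).+1 * eps.
  have := conservation st sS; rewrite E big_setU1 ?inE 1?eq_sym // big_set1 fe.
  rewrite (bigD1 e) ?in_arcs_in //= => H.
  have : 0 <= \sum_(i in arcs_in (tgt e) | i != e) t i.
    by apply: sumr_ge0 => i _; have /andP[] := throughput_range st i.
  rewrite exprS -mulrA; lra.
split=> //; apply: contraT => eF.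
have := bound _ sz; have := bound _ (ltnW sz).
by have [] := maximality st (esym fe) eF fF; lra.
Qed.

Lemma balancer_unit_flow i0 : balancer R G -> i0 \in inputs G ->
  exists T, [/\ forall e, 0 <= T e, halving T,
    forall e, ~~ alive (tgt e) -> T e = 0,
    forall e, src e \in inputs G -> T e = (src e == i0)%:R &
    forall e, tgt e \in outputs G -> T e = #|outputs G|%:R^-1].
Proof.
(* This [eps] gives equality in the smallness condition of [alive_fluid]. *)
move=> bal i0I; pose eps : R := (2 ^+ #|vertex G|)^-1.
have eps0 : 0 < eps by rewrite invr_gt0 exprn_gt0.
have eps1 : eps <= 1 by rewrite invf_le1 ?exprn_gt0 // exprn_ege1 // ler1n.
pose c v : R := if v \in outputs G then 1 else eps * (v == i0)%:R.
have cap : capacity_function c.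
  move=> v _; rewrite /c; case: ifP => _; first by rewrite ler01 lexx.
  by case: eqP => _; rewrite ?mulr1 ?mulr0 ?lexx ?ler01 // ltW.
have c1 o : o \in outputs G -> c o = 1 by rewrite /c => ->.
have cI i : i \in inputs G -> c i = eps * (i == i0)%:R.
  by move=> iI; rewrite /c (disjointFr (inputs_outputs_disjoint G) iI).
have [t [F [st cst]]] := bal c cap c1.
have t0 e : 0 <= t e by have /andP[] := throughput_range st e.
have flow : \sum_(o in outputs G) \sum_(e in arcs_in o) t e =
    \sum_(i in inputs G) \sum_(e in arcs_out i) t e.
  have := sum_arcs t; rewrite [X in _ + X](eq_bigr _ (conservation st)).
  exact: addIr.
have teps e : tgt e \in outputs G -> t e <= eps.
  move=> eO; have le : t e <= \sum_(o in outputs G) \sum_(e in arcs_in o) t e.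
    rewrite (bigD1 (tgt e)) //= arcs_in_output // big_set1 lerDl.
    by apply: sumr_ge0 => o _; apply: sumr_ge0.
  apply: le_trans le _; rewrite flow (bigD1 i0) //= -[leRHS]addr0; apply: lerD.
    have [/eqP/cards1P[f E] _] := input_degrees i0I; rewrite E big_set1.
    by have [] := input_rule st i0I E; rewrite cI // eqxx mulr1.
  apply: sumr_le0 => i /andP[iI ne].
  have [/eqP/cards1P[f E] _] := input_degrees iI; rewrite E big_set1.
  by have [] := input_rule st iI E; rewrite cI // (negPf ne) mulr0.
have fluid e : alive (tgt e) -> e \in F.
  by apply: alive_fluid st eps0 _ c1 teps e; rewrite mulfV // expf_neq0.
have tI e : src e \in inputs G -> t e = eps * (src e == i0)%:R.
  move=> iI; have [_] := input_rule st iI (arcs_out_input iI).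
  by rewrite cI // => ->//; apply: fluid; exact: input_alive_tgt.
have flow_eps : \sum_(o in outputs G) \sum_(e in arcs_in o) t e = eps.
  have [/eqP/cards1P[f E] _] := input_degrees i0I.
  rewrite flow (bigD1 i0) //= E big_set1.
  have /eqP fi0 : src f == i0 by have := set11 f; rewrite -E inE.
  rewrite tI fi0 // eqxx mulr1 big1 ?addr0 // => i /andP[iI ne].
  by apply: big1 => e; rewrite inE => /eqP ei; rewrite tI ei // (negPf ne) mulr0.
(* The total [eps] is shared equally because [t] is constant on the arcs into outputs. *)
have tO e : tgt e \in outputs G -> t e = eps / #|outputs G|%:R.
  move=> eO; have p0 : #|outputs G|%:R != 0 :> R.
    by rewrite pnatr_eq0 -lt0n; apply/card_gt0P; exists (tgt e).
  apply: (mulIf p0); rewrite divfK // -flow_eps mulr_natr -sumr_const.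
  apply: eq_bigr => o oO.
  have [/eqP/cards1P[f E] _] := output_degrees oO; rewrite E big_set1.
  have fo : tgt f \in outputs G by have := set11 f; rewrite -E inE => /eqP->.
  have into g : tgt g \in outputs G -> g \in arcs_into (outputs G).
    move=> gO; rewrite inE gO andbT; have [u|u] := arc_src_cases g.
      by rewrite (disjointFr (inputs_outputs_disjoint G) u).
    by rewrite (disjointFr (splitters_outputs_disjoint G) u).
  by apply: cst; exact: into.
(* Arcs with dead heads are reset to 0, since [t] may circulate there; [alive] agrees on both ends
   of an arc leaving a splitter, so halving survives. *)
exists (fun e => if alive (tgt e) then t e / eps else 0); split.
- by move=> e; case: ifP => // _; rewrite divr_ge0 // ltW.
- move=> e sS.
  have src_alive f : f \in arcs_in (src e) -> alive (tgt f) = alive (src e).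
    by rewrite inE => /eqP->.
  rewrite (eq_bigr (fun f => if alive (src e) then t f / eps else 0)); last first.
    by move=> f /src_alive ->.
  case: ifP => al; last first.
    rewrite mulr0; symmetry; apply: big1 => f _; case: ifP => // /alive_tgt.
    by rewrite al.
  have ae := alive_src al; rewrite ae -mulr_suml mulrA; congr (_ / _).
  rewrite (conservation st sS).
  have [f fe E] := arcs_out_splitter sS.
  rewrite E big_setU1 ?inE 1?eq_sym // big_set1.
  have /eqP sf : src f == src e by have := set22 e f; rewrite -E inE.
  have fF : f \in F by apply/fluid/alive_tgt; rewrite sf.
  have E' : arcs_out (src e) = [set f; e] by rewrite finset.setUC.
  (* Both outgoing arcs are fluid, so the rule applied in both orders makes them equal. *)
  have := outgoing_rule st sS E (fluid _ al).
  have := outgoing_rule st sS E' fF; rewrite /=; lra.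
- by move=> e /negPf->.
- by move=> e iI; rewrite input_alive_tgt // tI // mulrAC divff ?mul1r ?gt_eqF.
- by move=> e eO; rewrite alive_output // tO // mulrAC divff ?mul1r ?gt_eqF.
Qed.

Lemma balancer_splitters m : balancer R G ->
  #|inputs G|%:R * (#|outputs G|%:R * digit_potential m (#|outputs G|%:R^-1))
    <= 2 * #|splitters G|%:R :> R.
Proof.
move=> bal.
have unit_flow i : exists T, i \in inputs G -> [/\ forall e, 0 <= T e, halving T,
    forall e, ~~ alive (tgt e) -> T e = 0,
    forall e, src e \in inputs G -> T e = (src e == i)%:R &
    forall e, tgt e \in outputs G -> T e = #|outputs G|%:R^-1].
  (* The dummy zero flow off the inputs makes existence total in [i], as [choice] requires. *)
  have [/(balancer_unit_flow bal)[T HT]|_] := boolP (i \in inputs G).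
    by exists T.
  by exists (fun=> 0).
have {unit_flow} [T HT] := choice unit_flow.
(* The sum of the unit flows is again halving and equals 1 on every arc leaving an input. *)
have le1 e : \sum_(i in inputs G) T i e <= 1.
  apply: (halving_le1 (T := fun e => \sum_(i in inputs G) T i e))
    => {e} [e|e sS|e eI|e de].
  - by apply: sumr_ge0 => i /HT[].
  - rewrite mulr_sumr exchange_big; apply: eq_bigr => i /HT[_ hT _ _ _].
    exact: hT.
  - rewrite (bigD1 (src e)) //= big1 ?addr0.
      by have [_ _ _ -> //] := HT _ eI; rewrite eqxx.
    move=> i /andP[/HT[_ _ _ -> // _]]; by rewrite eq_sym => /negPf->.
  - by apply: big1 => i /HT[_ _ -> ].
have flow i : i \in inputs G ->
    #|outputs G|%:R * digit_potential m (#|outputs G|%:R^-1) <=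
    \sum_(s in splitters G) \sum_(e in arcs_in s) T i e.
  move=> /HT[T0 hT _ TI TO]; have := halving_potential m T0 hT.
  rewrite [X in _ <= X + _]big1 ?add0r; last first.
    move=> j jI; apply: big1 => e; rewrite inE => /eqP ej.
    by rewrite TI ?ej // digit_potential_nat.
  rewrite (eq_bigr (fun=> digit_potential m (#|outputs G|%:R^-1))); last first.
    move=> v vO; have [/eqP/cards1P[f E] _] := output_degrees vO.
    have := set11 f; rewrite -E inE => /eqP fv.
    by rewrite E big_set1 TO ?fv.
  by rewrite sumr_const mulr_natl.
(* After exchanging sums, each splitter is charged at most 1 for each of its two entering arcs. *)
rewrite [leLHS]mulr_natl -sumr_const; apply: le_trans (ler_sum _ flow) _.
rewrite exchange_big [leRHS]mulr_natr -sumr_const; apply: ler_sum => s sS /=.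
rewrite exchange_big /=; apply: le_trans (ler_sum _ (fun e _ => le1 e)) _.
by have [c _] := splitter_cards sS; rewrite sumr_const c.
Qed.

End Flows.
End Networks.

Theorem theorem4 (R : realType) (n p : nat) (G : splitter_network)
    (hG : np_balancer R G n p) :
  #|splitters G|%:R >=
    1 / 4 * #|inputs G|%:R * #|outputs G|%:R *
    limn (series (fun k : nat =>
      k%:R / 2 ^+ k * (binary_digit k (1 / #|outputs G|%:R : R))%:R : R)).
Proof.
have [bal _ _] := hG; rewrite -(mulrA (1 / 4)) (div1r #|outputs G|%:R).
set x : R := #|outputs G|%:R^-1; set L := limn _.
set np : R := #|inputs G|%:R * #|outputs G|%:R.
have S0 : 0 <= #|splitters G|%:R :> R by [].
(* Without inputs or without outputs the right-hand side is 0; otherwise division by [np] is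
   legitimate. *)
have [->|np0] := eqVneq np 0; first by rewrite mulr0 mul0r.
have {}np0 : 0 < np by rewrite lt0r np0 mulr_ge0.
have x0 : 0 <= x by rewrite invr_ge0.
have LS : L <= 2 * #|splitters G|%:R / np.
  apply: limr_le; first exact: is_cvg_weighted_digits.
  apply: nearW => m; rewrite ler_pdivlMr // mulrC /series /=.
  apply: le_trans (balancer_splitters m bal); rewrite mulrA ler_pM2l //.
  exact: weighted_digits_le.
(* This bound has the factor 1/2; nonnegativity of the splitter count weakens it to 1/4. *)
move: LS; rewrite ler_pdivlMr //; lra.
Qed.
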